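(* Let $(V,\mu,\nu)$ be an $IF$-normed space, let $p=(p_j)_{j\ge 0}\in SVA_+$, let $(x_{mn})_{m,n\ge 0}$ be a double sequence in $V$, let $x\in V$, and assume that $(x_{mn})$ is $(\bar N,p,*;1,0)$ summable to $x$. Then $x_{mn}\to x$ in $(V,\mu,\nu)$ if and only if for all $t>0$ $$\sup_{\lambda>1}\liminf_{m,n\to\infty}\mu\left(\frac{1}{P_{\lambda_m}-P_m}\sum_{j=m+1}^{\lambda_m}p_j(x_{jn}-x_{mn}),t\right)=1$$ and $$\inf_{\lambda>1}\limsup_{m,n\to\infty}\nu\left(\frac{1}{P_{\lambda_m}-P_m}\sum_{j=m+1}^{\lambda_m}p_j(x_{jn}-x_{mn}),t\right)=0.$$
   Context: An $IF$-normed space $(V,\mu,\nu)$ is a real vector space $V$ with zero vector $\theta$ together with functions (fuzzy sets) $\mu,\nu:V\times\mathbb{R}\to[0,1]$ such that for all $x,y\in V$ and $t,s\in\mathbb{R}$: (a) $\mu(x,t)=0$ for $t\le 0$; (b) $\mu(x,t)=1$ for all $t>0$ if and only if $x=\theta$; (c) $\mu(cx,t)=\mu(x,t/|c|)$ for all $t>0$ and real $c\neq 0$; (d) $\mu(x+y,t+s)\ge\min\{\mu(x,t),\mu(y,s)\}$; (e) $\lim_{t\to\infty}\mu(x,t)=1$, and $\lim_{t\to 0}\mu(x,t)=0$ if $x\ne\theta$; (f) $\nu(x,t)=1$ for $t\le 0$; (g) $\nu(x,t)=0$ for all $t>0$ if and only if $x=\theta$; (h) $\nu(cx,t)=\nu(x,t/|c|)$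 for all $t>0$ and real $c\ne 0$; (i) $\nu(x+y,t+s)\le\max\{\nu(x,t),\nu(y,s)\}$; (j) $\lim_{t\to\infty}\nu(x,t)=0$, and $\lim_{t\to 0}\nu(x,t)=1$ if $x\ne\theta$. A double sequence $(x_{mn})$ in $V$ converges to $x\in V$, written $x_{mn}\to x$, if for each $t>0$ and $\varepsilon\in(0,1)$ there is $n_0\in\mathbb{N}$ with $\mu(x_{mn}-x,t)>1-\varepsilon$ and $\nu(x_{mn}-x,t)<\varepsilon$ for all $m,n\ge n_0$. Limits of real double sequences are in Pringsheim's sense: $\liminf_{m,n\to\infty}a_{mn}=\lim_{N\to\infty}\inf_{m,n\ge N}a_{mn}$, and similarly for $\limsup$ (terms need only be defined for large $m,n$). The weight $p=(p_j)_{j\ge0}$ is a sequence of nonnegative reals with $p_0>0$ and $P_m=\sum_{j=0}^m p_j\to\infty$. Put $t^{10}_{mn}=\frac{1}{P_m}\sum_{j=0}^m p_jx_{jn}$. The double sequence $(x_{mn})$ is $(\bar N,p,*;1,0)$ summable to $x$ if $t^{10}_{mn}\to x$. For $\lambda>0$, $\lambda_m=[\lambda m]$ is the integer part of $\lambda m$. $SVA_+$ is the set of nonnegative sequences $p=(p_j)$ with $p_0>0$ such that $\liminf_{m\to\infty}\left|\frac{P_{\lambda_m}}{P_m}-1\right|>0$ for all $\lambda>0$ with $\lambda\ne1$. *)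

(* Defs.v *)
From HB Require Import structures.
From mathcomp Require Import all_boot all_order all_algebra.
From mathcomp Require Import all_classical all_reals all_analysis.

Set Implicit Arguments.
Unset Strict Implicit.
Unset Printing Implicit Defensive.

Import Order.TTheory GRing.Theory Num.Theory.
Import numFieldNormedType.Exports.

Local Open Scope classical_set_scope.
Local Open Scope ring_scope.

Record IF_norm (R : realType) (V : lmodType R) (mu nu : V -> R -> R) : Prop :=
  IFNorm {
    mu_ge0_le1 : forall x t, 0 <= mu x t <= 1 ;
    nu_ge0_le1 : forall x t, 0 <= nu x t <= 1 ;
    mu_npos : forall x t, t <= 0 -> mu x t = 0 ;
    mu_eq1 : forall x, (forall t, 0 < t -> mu x t = 1) <-> x = 0 ;
    mu_scale : forall (c : R) x t, c != 0 -> 0 < t ->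
      mu (c *: x) t = mu x (t / `|c|) ;
    mu_add : forall x y t s,
      Num.min (mu x t) (mu y s) <= mu (x + y) (t + s) ;
    mu_cvg_pinfty : forall x, mu x t @[t --> +oo] --> (1 : R) ;
    mu_cvg_0 : forall x, x != 0 -> mu x t @[t --> 0^'] --> (0 : R) ;
    nu_npos : forall x t, t <= 0 -> nu x t = 1 ;
    nu_eq0 : forall x, (forall t, 0 < t -> nu x t = 0) <-> x = 0 ;
    nu_scale : forall (c : R) x t, c != 0 -> 0 < t ->
      nu (c *: x) t = nu x (t / `|c|) ;
    nu_add : forall x y t s,
      nu (x + y) (t + s) <= Num.max (nu x t) (nu y s) ;
    nu_cvg_pinfty : forall x, nu x t @[t --> +oo] --> (0 : R) ;
    nu_cvg_0 : forall x, x != 0 -> nu x t @[t --> 0^'] --> (1 : R)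
  }.

Definition IF_cvg2 (R : realType) (V : lmodType R) (mu nu : V -> R -> R)
    (x : nat -> nat -> V) (l : V) : Prop :=
  forall t e : R, 0 < t -> 0 < e < 1 ->
    exists n0 : nat, forall m n : nat, (n0 <= m)%N -> (n0 <= n)%N ->
      1 - e < mu (x m n - l) t /\ nu (x m n - l) t < e.

(* Pringsheim lower and upper limits, valued in the extended reals; the limits
   over N always exist there, the infima (suprema) being monotone in N. *)
Definition liminf2 (R : realType) (a : nat -> nat -> R) : \bar R :=
  limn (fun N : nat => ereal_inf
    [set y | exists m n : nat, [/\ (N <= m)%N, (N <= n)%N & y = (a m n)%:E]]).

Definition limsup2 (R : realType) (a : nat -> nat -> R) : \bar R :=
  limn (fun N : nat => ereal_sup
    [set y | exists m n : nat, [/\ (N <= m)%N, (N <= n)%N & y = (a m n)%:E]]).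

Definition psum (R : realType) (p : nat -> R) (m : nat) : R :=
  \sum_(0 <= j < m.+1) p j.

Definition weight (R : realType) (p : nat -> R) : Prop :=
  [/\ forall j, 0 <= p j, 0 < p 0%N & psum p m @[m --> \oo] --> +oo].

(* For lambda > 0, [truncn] is the integer part. *)
Definition lam (R : realType) (lambda : R) (m : nat) : nat :=
  Num.truncn (lambda * m%:R).

Definition SVA_plus (R : realType) (p : nat -> R) : Prop :=
  [/\ forall j, 0 <= p j, 0 < p 0%N &
    forall lambda : R, 0 < lambda -> lambda != 1 ->
      (0 < limn_einf (fun m => `|psum p (lam lambda m) / psum p m - 1|%:E))%E].

Definition t10 (R : realType) (V : lmodType R) (p : nat -> R)
    (x : nat -> nat -> V) (m n : nat) : V :=
  (psum p m)^-1 *: \sum_(0 <= j < m.+1) p j *: x j n.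

Definition Np10_summable (R : realType) (V : lmodType R) (mu nu : V -> R -> R)
    (p : nat -> R) (x : nat -> nat -> V) (l : V) : Prop :=
  IF_cvg2 mu nu (t10 p x) l.

(* For the finitely many m with [psum p (lam lambda m) = psum p m] (p in
   SVA_plus, lambda > 1) the inverse is 0; this does not affect limits. *)
Definition moving_avg (R : realType) (V : lmodType R) (p : nat -> R)
    (x : nat -> nat -> V) (lambda : R) (m n : nat) : V :=
  (psum p (lam lambda m) - psum p m)^-1 *:
    \sum_(m.+1 <= j < (lam lambda m).+1) p j *: (x j n - x m n).

(* Main.v *)
Require Import Defs.
From HB Require Import structures.
From mathcomp Require Import all_boot all_order all_algebra.
From mathcomp Require Import all_classical all_reals all_analysis.
From mathcomp Require Import lra.

Set Implicit Arguments.
Unset Strict Implicit.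
Unset Printing Implicit Defensive.

Import Order.TTheory GRing.Theory Num.Theory.
Import numFieldNormedType.Exports.

Local Open Scope classical_set_scope.
Local Open Scope ring_scope.

(** Write s_mn = t10_mn - l, P = [psum p], and L = [lam lambda m] for a fixed
    lambda > 1.  Expressing the sums of p_j x_jn through the means t10 gives, as
    soon as P_L <> P_m, the identity ([moving_avgE])

      moving_avg_mn = s_Ln + P_m / (P_L - P_m) (s_Ln - s_mn) - (x_mn - l).

    Summability says that s tends to 0, hence so does s_Ln because L >= m, and
    the SVA condition makes the coefficient P_m / (P_L - P_m) eventually
    bounded ([SVA_gap_ratio]).  So, for every lambda > 1, the moving average
    and x_mn - l add up to a null double sequence
    ([fuzzy_null_moving_avg_add]).  If x -> l, every moving average is null too,
    which is more than the sup/inf conditions ask.  Conversely these conditions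
    provide, for each error level e, one lambda for which the moving averages
    are eventually within e, and this bounds x_mn - l by the fuzzy triangle
    inequality: lambda may depend on e, because the null sequence is available
    for each lambda.

    The two gradings never interact: mu and 1 - nu satisfy the same axioms
    ([fuzzy_norm]), so the argument is made once for a single grading
    ([fuzzy_tauberian]).  On the real side the sup of lower limits and the inf
    of upper limits are likewise reduced to one epsilon-N criterion by a change
    of sign ([ereal_sup_liminf2P], [ereal_inf_limsup2P]). *)

(** * Pringsheim lower and upper limits *)

Section PringsheimLimits.
Context {R : realType}.
Implicit Types (a : nat -> nat -> R) (M : R).

Lemma limn_nondecreasing (u : (\bar R)^nat) :
  {homo u : n m / (n <= m)%N >-> (n <= m)%E} -> limn u = ereal_sup (range u).
Proof.
by move=> u_nd; apply/cvg_lim => //; exact: ereal_nondecreasing_cvgn.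
Qed.

Let tail a (N : nat) : set (\bar R) :=
  [set y | exists m n : nat, [/\ (N <= m)%N, (N <= n)%N & y = (a m n)%:E]].

Let inf_tail_nd a : {homo (fun N => ereal_inf (tail a N)) :
  n m / (n <= m)%N >-> (n <= m)%E}.
Proof.
move=> N N' NN'; apply: le_ereal_inf => _ [m [n [Nm Nn ->]]].
by exists m, n; split=> //; exact: leq_trans NN' _.
Qed.

Lemma liminf2_sup a :
  liminf2 a = ereal_sup (range (fun N => ereal_inf (tail a N))).
Proof. exact/limn_nondecreasing/inf_tail_nd. Qed.

Lemma limsup2_liminf2 a : limsup2 a = (- liminf2 (fun m n => - a m n)%R)%E.
Proof.
rewrite /liminf2 -limeN.
  congr (limn _); apply/funext => N /=.
  rewrite -ereal_supN; congr ereal_sup; apply/seteqP; split=> y /=.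
    move=> [m [n [Nm Nn ->]]]; exists (- a m n)%:E => /=.
      by exists m, n.
    by rewrite /= opprK.
  by move=> [_ [m [n [Nm Nn ->]]] <-]; exists m, n; rewrite /= opprK.
exact/ereal_nondecreasing_is_cvgn/inf_tail_nd.
Qed.

(** As M bounds a, only M <= sup is at stake.  The lower limit is itself a
    supremum over N of infima of tails, so the three nested extrema unfold to a
    single epsilon-N statement, in which the index i may depend on e. *)
Lemma ereal_sup_liminf2P {I : Type} (D : set I) (a : I -> nat -> nat -> R) M :
  (forall i m n, a i m n <= M) ->
  ereal_sup [set liminf2 (a i) | i in D] = M%:E <->
  (forall e, 0 < e -> exists2 i, D i & exists N : nat, forall m n,
     (N <= m)%N -> (N <= n)%N -> M - e < a i m n).
Proof.
move=> aM; split=> [supE e e0|approx].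
  have : ((M - e)%:E < ereal_sup [set liminf2 (a i) | i in D])%E.
    by rewrite supE lte_fin ltrBlDr ltrDl.
  move=> /ereal_sup_gt[_ [i Di <-]].
  rewrite liminf2_sup => /ereal_sup_gt[_ [N _ <-]] lt_inf.
  exists i => //; exists N => m n Nm Nn; rewrite -lte_fin.
  by apply: (lt_le_trans lt_inf); apply: ereal_inf_lbound; exists m, n.
apply/eqP; rewrite eq_le; apply/andP; split.
  apply: ge_ereal_sup => _ [i Di <-].
  rewrite liminf2_sup; apply: ge_ereal_sup => _ [N _ <-].
  apply: (@le_trans _ _ (a i N N)%:E); last by rewrite lee_fin.
  by apply: ereal_inf_lbound; exists N, N.
apply/lee_subgt0Pr => e e0; have [i Di [N aN]] := approx e e0.
apply: le_ereal_sup_tmp; exists (liminf2 (a i)); first by exists i.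
rewrite liminf2_sup; apply: le_ereal_sup_tmp.
exists (ereal_inf (tail (a i) N)); first by exists N.
apply: le_ereal_inf_tmp => _ [m [n [Nm Nn ->]]].
by rewrite -EFinB lee_fin ltW// aN.
Qed.

Lemma ereal_inf_limsup2P {I : Type} (D : set I) (a : I -> nat -> nat -> R) M :
  (forall i m n, M <= a i m n) ->
  ereal_inf [set limsup2 (a i) | i in D] = M%:E <->
  (forall e, 0 < e -> exists2 i, D i & exists N : nat, forall m n,
     (N <= m)%N -> (N <= n)%N -> a i m n < M + e).
Proof.
move=> Ma.
have -> : ereal_inf [set limsup2 (a i) | i in D] =
    (- ereal_sup [set liminf2 (fun m n => - a i m n)%R | i in D])%E.
  rewrite -ereal_infN image_comp; congr ereal_inf; apply: eq_imagel => i _ /=.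
  exact: limsup2_liminf2.
have Na i m n : - a i m n <= - M by rewrite lerN2.
have -> : (- ereal_sup [set liminf2 (fun m n => - a i m n)%R | i in D] = M%:E
    <-> ereal_sup [set liminf2 (fun m n => - a i m n)%R | i in D] =
        (- M)%:E)%E.
  by rewrite EFinN; split=> [<-|->]; rewrite oppeK.
rewrite (ereal_sup_liminf2P _ Na); split=> approx e e0;
  have [i Di [N aN]] := approx e e0;
  exists i => //; exists N => m n Nm Nn; have := aN m n Nm Nn; lra.
Qed.

Lemma limn_einf_gt0 (u : nat -> R) : (0 < limn_einf (fun m => (u m)%:E))%E ->
  exists2 d : R, 0 < d & exists N : nat, forall m, (N <= m)%N -> d <= u m.
Proof.
rewrite limn_einf_lim (limn_nondecreasing (@nondecreasing_einfs _ _)).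
move=> /ereal_sup_gt[_ [N _ <-]] inf_gt0.
have inf_le m : (N <= m)%N -> (einfs (EFin \o u) N <= (u m)%:E)%E.
  by move=> Nm; apply: ereal_inf_lbound; exists m.
move: inf_gt0 inf_le; rewrite -/(EFin \o u).
case: (einfs _ N) => [r| |] //= r0 inf_le.
  by exists r; rewrite -?lte_fin//; exists N => m /inf_le; rewrite lee_fin.
by have := inf_le N (leqnn N).
Qed.

End PringsheimLimits.

(** * Gradings of a vector space *)

Section FuzzyNorm.
Context {R : realType} {V : lmodType R}.
Implicit Types (f : V -> R -> R) (y z : nat -> nat -> V) (c : nat -> R).

(** What mu and 1 - nu share that makes null double sequences stable under
    differences and bounded scalings. *)
Record fuzzy_norm f : Prop := FuzzyNorm {
  fuzzy_le1 : forall v t, f v t <= 1 ;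
  fuzzy_norm0 : forall t, 0 < t -> f 0 t = 1 ;
  fuzzyZ : forall k v t, k != 0 -> 0 < t -> f (k *: v) t = f v (t / `|k|) ;
  fuzzyD : forall v w t s, Num.min (f v t) (f w s) <= f (v + w) (t + s) }.

Lemma fuzzy_norm_mu (mu nu : V -> R -> R) : IF_norm mu nu -> fuzzy_norm mu.
Proof.
move=> h; split=> [v t|t t0|k v t|].
- by have /andP[] := mu_ge0_le1 h v t.
- exact: (mu_eq1 h 0).2 t t0.
- exact: mu_scale h k v t.
- exact: mu_add h.
Qed.

Lemma fuzzy_norm_nu (mu nu : V -> R -> R) : IF_norm mu nu ->
  fuzzy_norm (fun v t => 1 - nu v t).
Proof.
move=> h; split=> [v t|t t0|k v t k0 t0|v w t s].
- by have /andP[] := nu_ge0_le1 h v t; lra.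
- by rewrite ((nu_eq0 h 0).2 erefl t t0) subr0.
- by rewrite (nu_scale h).
- have := nu_add h v w t s; rewrite ge_min le_max => /orP[] ?.
    by apply/orP; left; lra.
  by apply/orP; right; lra.
Qed.

Definition fuzzy_null f y : Prop := forall t e : R, 0 < t -> 0 < e ->
  exists N : nat, forall m n, (N <= m)%N -> (N <= n)%N -> 1 - e < f (y m n) t.

Lemma IF_cvg2P (mu nu : V -> R -> R) (x : nat -> nat -> V) (l : V) :
  IF_cvg2 mu nu x l <->
  fuzzy_null mu (fun m n => x m n - l) /\
  fuzzy_null (fun v t => 1 - nu v t) (fun m n => x m n - l).
Proof.
split=> [xl|[mu0 nu0] t e t0 /andP[e0 _]].
  (* Errors e >= 1, excluded from the definition of convergence, are handled
     by the smaller error min(e, 1/2). *)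
  have shrink (t e : R) : 0 < t -> 0 < e -> exists N : nat, forall m n,
      (N <= m)%N -> (N <= n)%N ->
      1 - e < mu (x m n - l) t /\ nu (x m n - l) t < e.
    move=> t0 e0; have [|N xN] := xl t (Num.min e 2^-1) t0.
      by rewrite lt_min gt_min e0; apply/andP; split; lra.
    exists N => m n Nm Nn; have [] := xN m n Nm Nn.
    rewrite lt_min => mu_gt /andP[nu_lt _]; split=> //.
    have : Num.min e 2^-1 <= e by rewrite ge_min lexx.
    lra.
  split=> t e t0 e0; have [N xN] := shrink t e t0 e0;
    exists N => m n Nm Nn; have [] := xN m n Nm Nn; lra.
have [N1 mu1] := mu0 _ _ t0 e0; have [N2 nu2] := nu0 _ _ t0 e0.
exists (maxn N1 N2) => m n; rewrite !geq_max => /andP[Nm1 Nm2] /andP[Nn1 Nn2].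
have := mu1 m n Nm1 Nn1; have := nu2 m n Nm2 Nn2; split; lra.
Qed.

Section Theory.
Context {f : V -> R -> R} (hf : fuzzy_norm f).

(** The triangle inequality for v + 0, with 0 taken at the time t - s left
    over, where its grade is 1. *)
Lemma fuzzy_le v (s t : R) : s <= t -> f v s <= f v t.
Proof.
rewrite le_eqVlt => /predU1P[->//|st].
have := fuzzyD hf v 0 s (t - s).
by rewrite (fuzzy_norm0 hf) ?subr_gt0// addr0 subrKC (min_idPl _)// fuzzy_le1.
Qed.

(** Allowing k = 0 is what lets coefficients be controlled by an upper bound
    only. *)
Lemma fuzzyZ_le k v (C t : R) : 0 < C -> `|k| <= C -> 0 < t ->
  f v (t / C) <= f (k *: v) t.
Proof.
move=> C0 kC t0; have [->|k0] := eqVneq k 0.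
  by rewrite scale0r (fuzzy_norm0 hf)// fuzzy_le1.
rewrite (fuzzyZ hf)//; apply: fuzzy_le.
by rewrite ler_pM2l// lef_pV2// posrE normr_gt0.
Qed.

Lemma fuzzyN v (t : R) : 0 < t -> f (- v) t = f v t.
Proof.
by move=> t0; rewrite -scaleN1r (fuzzyZ hf) ?oppr_eq0 ?oner_eq0// normrN1 divr1.
Qed.

Lemma fuzzyB_gt v w (t e : R) : 0 < t ->
  1 - e < f v (t / 2) -> 1 - e < f w (t / 2) -> 1 - e < f (v - w) t.
Proof.
move=> t0 fv fw; rewrite [t]splitr; apply: lt_le_trans (fuzzyD hf _ _ _ _).
by rewrite lt_min fv fuzzyN ?divr_gt0.
Qed.

Lemma fuzzy_nullB y z : fuzzy_null f y -> fuzzy_null f z ->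
  fuzzy_null f (fun m n => y m n - z m n).
Proof.
move=> y0 z0 t e t0 e0; have t20 : 0 < t / 2 by rewrite divr_gt0.
have [N1 yN] := y0 _ _ t20 e0; have [N2 zN] := z0 _ _ t20 e0.
exists (maxn N1 N2) => m n; rewrite !geq_max => /andP[m1 m2] /andP[n1 n2].
by apply: fuzzyB_gt; [|exact: yN|exact: zN].
Qed.

Lemma fuzzy_nullZ c y (C : R) (N0 : nat) : 0 < C ->
  (forall m, (N0 <= m)%N -> `|c m| <= C) ->
  fuzzy_null f y -> fuzzy_null f (fun m n => c m *: y m n).
Proof.
move=> C0 cC y0 t e t0 e0; have [N yN] := y0 _ _ (divr_gt0 t0 C0) e0.
exists (maxn N0 N) => m n; rewrite !geq_max => /andP[m0 m1] /andP[n0 n1].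
exact: lt_le_trans (yN m n m1 n1) (fuzzyZ_le _ C0 (cC m m0) t0).
Qed.

End Theory.

Lemma fuzzy_null_reindex f y (k : nat -> nat) : (forall m, (m <= k m)%N) ->
  fuzzy_null f y -> fuzzy_null f (fun m n => y (k m) n).
Proof.
move=> mk y0 t e t0 e0; have [N yN] := y0 _ _ t0 e0; exists N => m n Nm Nn.
by apply: yN => //; exact: leq_trans Nm (mk m).
Qed.

Lemma fuzzy_null_eventually f y z (N0 : nat) :
  (forall m n, (N0 <= m)%N -> y m n = z m n) ->
  fuzzy_null f y -> fuzzy_null f z.
Proof.
move=> yz y0 t e t0 e0; have [N yN] := y0 _ _ t0 e0.
exists (maxn N0 N) => m n; rewrite !geq_max => /andP[m0 m1] /andP[n0 n1].
by rewrite -yz// yN.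
Qed.

End FuzzyNorm.

(** * Weighted means and moving averages *)

Section MovingAverage.
Context {R : realType} {V : lmodType R}.
Context (p : nat -> R) (x : nat -> nat -> V) (l : V) (hp : SVA_plus p).

Let p_ge0 j : 0 <= p j. Proof. by have [] := hp. Qed.

Lemma psum_gt0 m : 0 < psum p m.
Proof.
have [_ p00 _] := hp; rewrite /psum big_nat_recl//=.
by apply: ltr_pwDl => //; apply: sumr_ge0.
Qed.

Lemma psumB m k : (m <= k)%N ->
  psum p k - psum p m = \sum_(m.+1 <= j < k.+1) p j.
Proof.
move=> mk; rewrite /psum (@big_cat_nat _ _ _ m.+1 0 k.+1)//=.
by rewrite addrAC subrr add0r.
Qed.

Lemma lam_ge (lambda : R) m : 1 < lambda -> (m <= lam lambda m)%N.
Proof.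
move=> lambda1; rewrite /lam truncn_ge_nat; last first.
  by rewrite mulr_ge0// ltW// (lt_trans ltr01).
by rewrite ler_peMl// ltW.
Qed.

Definition gap_ratio (lambda : R) m : R :=
  psum p m / (psum p (lam lambda m) - psum p m).

(** The ratio is the inverse of P_L / P_m - 1, which the SVA condition keeps
    away from 0; the absolute value there is harmless since P_L >= P_m. *)
Lemma SVA_gap_ratio (lambda : R) : 1 < lambda ->
  exists2 C : R, 0 < C & exists N : nat, forall m, (N <= m)%N ->
    psum p (lam lambda m) - psum p m != 0 /\ `|gap_ratio lambda m| <= C.
Proof.
move=> lambda1; have [_ _ sva] := hp.
have [|d d0 [N dN]] := limn_einf_gt0 (sva lambda (lt_trans ltr01 lambda1) _).
  by rewrite gt_eqF.
exists d^-1; first by rewrite invr_gt0.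
exists N => m Nm; have P0 := psum_gt0 m; have := dN m Nm.
have gap_ge0 : 0 <= psum p (lam lambda m) - psum p m.
  by rewrite psumB ?lam_ge// sumr_ge0.
have -> : psum p (lam lambda m) / psum p m - 1 =
    (psum p (lam lambda m) - psum p m) / psum p m.
  by rewrite mulrBl divff ?gt_eqF.
rewrite /gap_ratio; move: gap_ge0; set D := _ - _ => D_ge0.
rewrite ger0_norm ?divr_ge0 ?(ltW P0)// => dD.
have D0 : 0 < D.
  rewrite lt0r D_ge0 andbT; apply: contraTneq dD => ->.
  by rewrite mul0r -ltNge.
split; first by rewrite gt_eqF.
by rewrite ger0_norm ?divr_ge0 ?(ltW P0)// -invf_div lef_pV2// posrE divr_gt0.
Qed.

Let s m n := t10 p x m n - l.

(** Since P_L t_L - P_m t_m = (P_L - P_m) t_L + P_m (t_L - t_m), only a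
    difference of two means carries a coefficient that could be large, and
    centering at l costs nothing there. *)
Lemma moving_avgE (lambda : R) m n : 1 < lambda ->
  psum p (lam lambda m) - psum p m != 0 ->
  moving_avg p x lambda m n =
    s (lam lambda m) n
    + gap_ratio lambda m *: (s (lam lambda m) n - s m n) - (x m n - l).
Proof.
move=> lambda1 D0; have mL := lam_ge m lambda1.
rewrite /moving_avg /gap_ratio /s; set L := lam lambda m in D0 mL *.
have sumE k : \sum_(0 <= j < k.+1) p j *: x j n = psum p k *: t10 p x k n.
  by rewrite /t10 scalerA divff ?scale1r// gt_eqF ?psum_gt0.
have -> : \sum_(m.+1 <= j < L.+1) p j *: (x j n - x m n) =
    psum p L *: t10 p x L n - psum p m *: t10 p x m n
    - (psum p L - psum p m) *: x m n.
  rewrite -!sumE psumB// (@big_cat_nat _ _ _ m.+1 0 L.+1)//=.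
  rewrite [X in X - _]addrAC subrr add0r scaler_suml -sumrB.
  by apply: eq_bigr => j _; rewrite scalerBr.
have -> : psum p L *: t10 p x L n - psum p m *: t10 p x m n =
    (psum p L - psum p m) *: t10 p x L n
    + psum p m *: (t10 p x L n - t10 p x m n).
  by rewrite scalerBl scalerBr addrA subrK.
move: (t10 p x L n) (t10 p x m n) => a b.
rewrite scalerBr scalerDr !scalerA mulVf// !scale1r [_^-1 * _]mulrC.
rewrite [- (b - l)]opprB addrA subrK.
by rewrite opprB [a - l + _]addrAC addrA subrK.
Qed.

Lemma fuzzy_null_moving_avg_add {f : V -> R -> R} (hf : fuzzy_norm f)
    (lambda : R) : 1 < lambda -> fuzzy_null f s ->
  fuzzy_null f (fun m n => moving_avg p x lambda m n + (x m n - l)).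
Proof.
move=> lambda1 s0; have [C C0 [N CN]] := SVA_gap_ratio lambda1.
have sL0 := fuzzy_null_reindex (fun m => lam_ge m lambda1) s0.
have rest0 := fuzzy_nullZ hf C0 (fun m Nm => (CN m Nm).2)
  (fuzzy_nullB hf s0 sL0).
have := fuzzy_nullB hf sL0 rest0.
apply: (@fuzzy_null_eventually _ _ _ _ _ N) => m n Nm.
by rewrite moving_avgE ?(CN m Nm).1// subrK -scalerN opprB.
Qed.

(** In the forward direction every lambda > 1 works for all t and e, and 2 is
    an arbitrary choice.  In the backward direction the lambda supplied for
    (t / 2, e) is only used at that error level. *)
Lemma fuzzy_tauberian {f : V -> R -> R} (hf : fuzzy_norm f) :
  fuzzy_null f s ->
  fuzzy_null f (fun m n => x m n - l) <->
  forall t, 0 < t -> forall e, 0 < e -> exists2 lambda : R, 1 < lambda &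
    exists N : nat, forall m n, (N <= m)%N -> (N <= n)%N ->
      1 - e < f (moving_avg p x lambda m n) t.
Proof.
move=> s0; split=> [xl t t0 e e0|approx t e t0 e0].
  have lambda1 : (1 : R) < 2 by rewrite ltr1n.
  exists 2 => //.
  have [N MN] :=
    fuzzy_nullB hf (fuzzy_null_moving_avg_add hf lambda1 s0) xl t0 e0.
  by exists N => m n Nm Nn; have := MN m n Nm Nn; rewrite addrK.
have t20 : 0 < t / 2 by rewrite divr_gt0.
have [lambda lambda1 [N1 MN]] := approx _ t20 _ e0.
have [N2 yN] := fuzzy_null_moving_avg_add hf lambda1 s0 t20 e0.
exists (maxn N1 N2) => m n; rewrite !geq_max => /andP[m1 m2] /andP[n1 n2].
rewrite -[x m n - l](addKr (moving_avg p x lambda m n)) [- _ + _]addrC.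
by apply: (fuzzyB_gt hf) => //; [exact: yN|exact: MN].
Qed.

End MovingAverage.

Theorem theorem22 (R : realType) (V : lmodType R) (mu nu : V -> R -> R)
    (hIF : IF_norm mu nu) (p : nat -> R) (hw : weight p) (hp : SVA_plus p)
    (x : nat -> nat -> V) (l : V) (hx : Np10_summable mu nu p x l) :
  IF_cvg2 mu nu x l <->
  (forall t : R, 0 < t ->
    ereal_sup [set liminf2 (fun m n => mu (moving_avg p x lambda m n) t)
              | lambda in [set lambda : R | 1 < lambda]] = 1%:E
    /\
    ereal_inf [set limsup2 (fun m n => nu (moving_avg p x lambda m n) t)
              | lambda in [set lambda : R | 1 < lambda]] = 0%:E).
Proof.
have hmu := fuzzy_norm_mu hIF; have hnu := fuzzy_norm_nu hIF.
have [smu snu] := (IF_cvg2P _ _ _ _).1 hx.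
have muP t : _ <-> _ := @ereal_sup_liminf2P R R [set lambda | 1 < lambda]
  (fun lambda m n => mu (moving_avg p x lambda m n) t) 1
  (fun _ _ _ => fuzzy_le1 hmu _ _).
have nu0 v t : 0 <= nu v t by have /andP[] := nu_ge0_le1 hIF v t.
have nuP t : _ <-> _ := @ereal_inf_limsup2P R R [set lambda | 1 < lambda]
  (fun lambda m n => nu (moving_avg p x lambda m n) t) 0
  (fun _ _ _ => nu0 _ _).
rewrite IF_cvg2P (fuzzy_tauberian hp hmu smu).
rewrite (fuzzy_tauberian hp hnu snu); split=> [[cmu cnu] t t0|c].
  split; first by apply/muP => e e0; exact: cmu.
  apply/nuP => e e0; have [lambda lambda1 [N nuN]] := cnu t t0 e e0.
  by exists lambda => //; exists N => m n Nm Nn; have := nuN m n Nm Nn; lra.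
split=> t t0 e e0; first exact: ((muP t).1 (c t t0).1 e e0).
have [lambda lambda1 [N nuN]] := (nuP t).1 (c t t0).2 e e0.
by exists lambda => //; exists N => m n Nm Nn; have := nuN m n Nm Nn; lra.
Qed.
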